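(* Let $k\geq 2$ be an integer. For any graphs $G$ and $H$ with minimum degree $\delta(H)\geq k-1$, \[ 2k|V(G)|\leq \gamma_{\times kR}(cor(G,H))\leq 2\gamma_{\times k}(cor(G,H)), \] where $cor(G,H)$ is the corona graph of $G$ and $H$.
   Context: All graphs are finite, undirected and simple. For an integer $k\geq 1$ and a graph $G=(V,E)$ with minimum degree at least $k-1$, a Roman $k$-tuple dominating function (R$k$DF) on $G$ is a function $f\colon V\to\{0,1,2\}$ such that every vertex $v$ with $f(v)=0$ has at least $k$ neighbors $w$ with $f(w)=2$, and every vertex $v$ with $f(v)\neq 0$ has at least $k-1$ neighbors $w$ with $f(w)=2$. The weight of $f$ is $f(V)=\sum_{v\in V}f(v)$, and $\gamma_{\times kR}(G)$ is the minimum weight of an R$k$DF on $G$. A $k$-tuple dominating set of $G$ is a subset $S\subseteq V$ with $|N_G[v]\cap S|\geq k$ for every $v\in V$, where $N_G[v]$ is the closed neighborhood of $v$; $\gamma_{\times k}(G)$ is the minimum cardinality of such a set. For graphs $G$ (of order $n$) and $H$, the corona graph $cor(G,H)$ is obtained by taking one copy of $G$ and $n$ disjoint copies of $H$ and joining every vertex of the $i$-th copy of $H$ to the $i$-th vertex of $G$, for each $i$. *)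

(* Defs.v *)
From mathcomp Require Import all_boot.

Set Implicit Arguments.
Unset Strict Implicit.
Unset Printing Implicit Defensive.

Record sgraph := SGraph {
  vertex :> finType;
  adj : rel vertex;
  adj_sym : symmetric adj;
  adj_irrefl : irreflexive adj
}.

Definition nbhd (G : sgraph) (v : G) : {set G} := [set w | adj v w].

Definition closed_nbhd (G : sgraph) (v : G) : {set G} := v |: nbhd v.

Definition degree (G : sgraph) (v : G) : nat := #|nbhd v|.

(* Every degree is less than #|G|, so the neutral element does not affect the
   minimum when G has a vertex; the null graph gets minimum degree 0. *)
Definition min_degree (G : sgraph) : nat := \big[minn/#|G|]_(v : G) degree v.

Definition roman_fun (G : sgraph) := {ffun G -> 'I_3}.

Definition weight (G : sgraph) (f : roman_fun G) : nat := \sum_(v : G) f v.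

Definition nbhd2 (G : sgraph) (f : roman_fun G) (v : G) : {set G} :=
  [set w in nbhd v | f w == 2 :> nat].

Definition is_RkDF (k : nat) (G : sgraph) (f : roman_fun G) : bool :=
  [forall v : G, if f v == 0 :> nat then k <= #|nbhd2 f v|
                 else k - 1 <= #|nbhd2 f v|].

Definition all_two (G : sgraph) : roman_fun G := [ffun=> ord_max].

(* The constant function 2 only starts the search: it is an RkDF as soon as
   the minimum degree is at least k - 1 (see gamma_kR_spec), so that the value
   is the minimum weight of an RkDF. *)
Definition gamma_kR (k : nat) (G : sgraph) : nat :=
  weight [arg min_(f < all_two G | is_RkDF k f) weight f].

Definition is_kTDS (k : nat) (G : sgraph) (S : {set G}) : bool :=
  [forall v : G, k <= #|closed_nbhd v :&: S|].

(* As above, the full vertex set only starts the search. *)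
Definition gamma_k (k : nat) (G : sgraph) : nat :=
  #|[arg min_(S < [set: G] | is_kTDS k S) #|S| ]|.

(* inl x is the vertex x of G; inr (x, u) is the vertex u in the copy of H
   attached to x. *)
Definition corona_adj (G H : sgraph) : rel (G + G * H) := fun a b =>
  match a, b with
  | inl x, inl y => adj x y
  | inl x, inr (y, _) => x == y
  | inr (x, _), inl y => x == y
  | inr (x, u), inr (y, v) => (x == y) && adj u v
  end.

Lemma corona_adj_sym (G H : sgraph) : symmetric (@corona_adj G H).
Proof.
by move=> [x|[x u]] [y|[y v]] /=; rewrite ?(adj_sym x) ?(adj_sym u) // eq_sym.
Qed.

Lemma corona_adj_irrefl (G H : sgraph) : irreflexive (@corona_adj G H).
Proof. by move=> [x|[x u]] /=; rewrite !adj_irrefl ?andbF. Qed.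

Definition corona (G H : sgraph) : sgraph :=
  SGraph (@corona_adj_sym G H) (@corona_adj_irrefl G H).

Lemma degree_lt (G : sgraph) (v : G) : degree v < #|G|.
Proof.
rewrite /degree -[X in _ < X]cardsT; apply: proper_card; rewrite properT.
by apply/eqP => E; move: (in_setT v); rewrite -E inE adj_irrefl.
Qed.

Lemma min_degree_le (G : sgraph) (v : G) : min_degree G <= degree v.
Proof.
rewrite /min_degree; have: v \in index_enum G by rewrite mem_index_enum.
elim: (index_enum G) => //= x s IHs; rewrite inE big_cons geq_min.
by case/predU1P=> [->|/IHs ->]; rewrite ?leqnn ?orbT.
Qed.

Lemma min_degreeP (G : sgraph) (d : nat) : 0 < #|G| ->
  reflect (forall v : G, d <= degree v) (d <= min_degree G).
Proof.
move=> G_gt0; apply: (iffP idP) => [dG v|dG].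
  exact: leq_trans dG (min_degree_le v).
have [v0 _] := card_gt0P G_gt0.
rewrite /min_degree; apply: (big_ind (fun m => d <= m)) => [|m n dm dn|v _].
- exact: leq_trans (dG v0) (ltnW (degree_lt v0)).
- by rewrite leq_min dm.
- exact: dG.
Qed.

Lemma min_degree_null (G : sgraph) : #|G| = 0 -> min_degree G = 0.
Proof.
move=> G0; rewrite /min_degree; elim: (index_enum G) => [|v s _].
  by rewrite big_nil.
by have := fintype0 v G0.
Qed.

Lemma all_two_RkDF (k : nat) (G : sgraph) :
  k - 1 <= min_degree G -> is_RkDF k (all_two G).
Proof.
move=> kG; apply/forallP => v; rewrite ffunE /=.
apply: leq_trans kG _; apply: leq_trans (min_degree_le v) _.
by apply: subset_leq_card; apply/subsetP => w vw; rewrite inE vw ffunE.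
Qed.

Lemma setT_kTDS (k : nat) (G : sgraph) :
  k - 1 <= min_degree G -> is_kTDS k [set: G].
Proof.
move=> kG; apply/forallP => v; rewrite setIT cardsU1 inE adj_irrefl /= add1n.
by rewrite -[_.+1]add1n -leq_subLR; exact: leq_trans kG (min_degree_le v).
Qed.

Lemma gamma_kR_spec (k : nat) (G : sgraph) : k - 1 <= min_degree G ->
  (exists2 f : roman_fun G, is_RkDF k f & weight f = gamma_kR k G) /\
  (forall f : roman_fun G, is_RkDF k f -> gamma_kR k G <= weight f).
Proof.
move=> kG; rewrite /gamma_kR; case: arg_minnP; first exact: all_two_RkDF.
by move=> f fP fmin; split; [exists f | exact: fmin].
Qed.

Lemma gamma_k_spec (k : nat) (G : sgraph) : k - 1 <= min_degree G ->
  (exists2 S : {set G}, is_kTDS k S & #|S| = gamma_k k G) /\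
  (forall S : {set G}, is_kTDS k S -> gamma_k k G <= #|S|).
Proof.
move=> kG; rewrite /gamma_k; case: arg_minnP; first exact: setT_kTDS.
by move=> S SP Smin; split; [exists S | exact: Smin].
Qed.

(* With gamma_kR_spec and gamma_k_spec: both numbers of the corona are genuine
   minima under these hypotheses. *)
Lemma corona_min_degree (k : nat) (G H : sgraph) : 2 <= k -> 0 < #|G| ->
  k - 1 <= min_degree H -> k - 1 <= min_degree (corona G H).
Proof.
move=> k2 G_gt0 kH.
have [x0 _] := card_gt0P G_gt0.
apply/min_degreeP; first by apply/card_gt0P; exists (inl x0).
have copyH (x : G) (A : {set H}) (a : corona G H) :
    {in A, forall u, corona_adj a (inr (x, u))} -> #|A| <= degree a.
  move=> aA; rewrite -(card_imset (mem A) (_ : injective (fun u => inr (x, u) : corona G H))).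
    by apply: subset_leq_card; apply/subsetP => _ /imsetP[u uA ->]; rewrite inE; exact: aA.
  by move=> u v [].
move=> [x|[x u]].
  apply: leq_trans (copyH x [set: H] _ _); last by move=> u _ /=.
  rewrite cardsT; apply: leq_trans kH _.
  case: (posnP #|H|) => [H0|/card_gt0P[u _]]; first by rewrite min_degree_null.
  exact: leq_trans (min_degree_le u) (ltnW (degree_lt u)).
apply: leq_trans (copyH x (nbhd u) _ _); last first.
  by move=> v; rewrite inE /= eqxx.
exact: leq_trans kH (min_degree_le u).
Qed.

(* Main.v *)
(* Lower bound: let [v] lie in the copy of [H] at a vertex [x] of [G]. Its closed
   neighborhood lies in the block formed by [x] and that copy, so the block has
   weight at least [2k] when [f v] is [0] or [2]. If [f v = 1], take a neighbor [w]
   of [v] in the same copy: either [f w] is [0] or [2] and the same count applies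
   to [w], or [f w = 1] and the block weight is at least [1 + 1 + 2(k - 1)].
   Upper bound: twice the indicator of a k-tuple dominating set is an RkDF. *)
Require Import Defs.
From mathcomp Require Import all_boot zify.

Set Implicit Arguments.
Unset Strict Implicit.

(** As [adj] is irreflexive, [v] is not in [nbhd2 f v], so its own value adds to the 2 from each
    vertex of that set. *)
Lemma nbhd2_weight_leq (G : sgraph) (f : roman_fun G) (v : G) (A : {set G}) :
  v \in A -> nbhd2 f v \subset A ->
  f v + 2 * #|nbhd2 f v| <= \sum_(a in A) f a.
Proof.
move=> vA sub; rewrite (big_setD1 v vA) /= leq_add2l.
have subD : nbhd2 f v \subset A :\ v.
  by rewrite subsetD1 sub !inE adj_irrefl.
rewrite (big_setID (nbhd2 f v)) /= (setIidPr subD).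
apply: leq_trans (leq_addr _ _).
rewrite mulnC -sum_nat_const; apply: leq_sum => a.
by rewrite inE => /andP[_ /eqP ->].
Qed.

(** Value 0 gives [0 + 2 * k] and value 2 gives [2 + 2 * (k - 1)]; value 1 would fall one short. *)
Lemma RkDF_weight_leq (k : nat) (G : sgraph) (f : roman_fun G) (v : G)
    (A : {set G}) :
  is_RkDF k f -> f v != 1 :> nat -> v \in A -> nbhd2 f v \subset A ->
  2 * k <= \sum_(a in A) f a.
Proof.
move=> /forallP/(_ v) fv fv1 vA sub.
apply: leq_trans (nbhd2_weight_leq vA sub).
by case: (f v) fv fv1 => [[|[|[|m]]] ltm] //=; lia.
Qed.

Definition corona_root (G H : sgraph) (a : corona G H) : G :=
  match a with inl x => x | inr (x, _) => x end.

Definition corona_block (G H : sgraph) (x : G) : {set corona G H} :=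
  [set a | corona_root a == x].

Lemma nbhd2_corona_block (G H : sgraph) (f : roman_fun (corona G H)) x (u : H) :
  nbhd2 f (inr (x, u)) \subset corona_block H x.
Proof.
apply/subsetP => -[y|[y v]]; rewrite !inE /= => /andP[].
  by rewrite eq_sym.
by case/andP; rewrite eq_sym.
Qed.

Lemma corona_block_weight (k : nat) (G H : sgraph)
    (f : roman_fun (corona G H)) (x : G) (u u' : H) :
  is_RkDF k f -> adj u u' -> 2 * k <= \sum_(a in corona_block H x) f a.
Proof.
move=> fP uu'; pose v : corona G H := inr (x, u); pose w : corona G H := inr (x, u').
have vB : v \in corona_block H x by rewrite inE.
have wB : w \in corona_block H x by rewrite inE.
have [fv1|] := eqVneq (f v : nat) 1; last first.
  by move=> fv; apply: RkDF_weight_leq fP fv vB (nbhd2_corona_block _ _ _).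
have [fw1|] := eqVneq (f w : nat) 1; last first.
  by move=> fw; apply: RkDF_weight_leq fP fw wB (nbhd2_corona_block _ _ _).
(* Since [f w = 1], [w] is outside [nbhd2 f v]: setting it aside gains 1 and keeps the count around
   [v] intact. *)
rewrite (big_setD1 w wB) /= fw1.
have vBw : v \in corona_block H x :\ w.
  rewrite in_setD1 vB andbT; apply/eqP => -[E].
  by rewrite E adj_irrefl in uu'.
have sub : nbhd2 f v \subset corona_block H x :\ w.
  by rewrite subsetD1 nbhd2_corona_block !inE fw1 andbF.
have := nbhd2_weight_leq vBw sub; move: (forallP fP v); rewrite fv1 /=; lia.
Qed.

Lemma corona_weight (G H : sgraph) (f : roman_fun (corona G H)) :
  weight f = \sum_(x : G) \sum_(a in corona_block H x) f a.
Proof.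
rewrite /weight (partition_big (@corona_root G H) predT) //=.
by apply: eq_bigr => x _; apply: eq_bigl => a; rewrite inE.
Qed.

Definition two_on (G : sgraph) (S : {set G}) : roman_fun G :=
  [ffun v => if v \in S then ord_max else ord0].

Lemma weight_two_on (G : sgraph) (S : {set G}) : weight (two_on S) = 2 * #|S|.
Proof.
rewrite mulnC -sum_nat_const big_mkcond.
by apply: eq_bigr => v _; rewrite ffunE; case: ifP.
Qed.

Lemma two_on_RkDF (k : nat) (G : sgraph) (S : {set G}) :
  is_kTDS k S -> is_RkDF k (two_on S).
Proof.
move=> /forallP SP; apply/forallP => v; move: (SP v).
have -> : nbhd2 (two_on S) v = nbhd v :&: S.
  by apply/setP => w; rewrite !inE ffunE; case: (w \in S).
(* If [v] is in [S], it is itself one of the [k] dominators, which leaves [k - 1] neighbors;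
   otherwise all [k] are neighbors. *)
rewrite /closed_nbhd setIUl ffunE; case vS: (v \in S) => /=.
  have -> : [set v] :&: S = [set v] by apply/setIidPl; rewrite sub1set.
  rewrite cardsU1 !inE adj_irrefl /=; lia.
have -> : [set v] :&: S = set0 by apply: disjoint_setI0; rewrite disjoints1 vS.
by rewrite set0U.
Qed.

Lemma gamma_kR_leq_double (k : nat) (G : sgraph) :
  k - 1 <= min_degree G -> gamma_kR k G <= 2 * gamma_k k G.
Proof.
move=> kG; have [[S SP <-] _] := gamma_k_spec kG.
by rewrite -weight_two_on; apply: (gamma_kR_spec kG).2; apply: two_on_RkDF.
Qed.

Theorem theorem6 (k : nat) (hk : 2 <= k) (G H : sgraph)
  (hH : k - 1 <= min_degree H) :
  2 * k * #|G| <= gamma_kR k (corona G H) /\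
  gamma_kR k (corona G H) <= 2 * gamma_k k (corona G H).
Proof.
(* Over the null graph the corona has no vertices, so every weight is an empty sum. *)
have [G0|G_gt0] := posnP #|G|.
  rewrite G0 muln0; split=> //; rewrite /gamma_kR corona_weight big1 // => x.
  by have := fintype0 x G0.
have kC := corona_min_degree hk G_gt0 hH.
split; last exact: gamma_kR_leq_double.
(* From [2 <= k], [min_degree H] is positive: [H] has a vertex, and that vertex has a neighbor. *)
have [u _] : exists u : H, u \in H.
  by apply/card_gt0P; rewrite lt0n; apply/eqP => /min_degree_null; lia.
have [u'] : exists u', u' \in nbhd u.
  by apply/card_gt0P; have := min_degree_le u; rewrite /degree; lia.
rewrite inE => uu'; have [[f fP <-] _] := gamma_kR_spec kC.
rewrite corona_weight mulnC -sum_nat_const.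
by apply: leq_sum => x _; apply: corona_block_weight fP uu'.
Qed.
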